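(* Every strongly NUS-nil clean ring is strongly clean.
   Context: All rings are associative with identity, not necessarily commutative. An element $e\in R$ is square-idempotent if $e^2=e^4$. An element $a\in R$ is strongly square-nil clean if $a=e+n$ with $e\in R$ square-idempotent, $n\in R$ nilpotent and $en=ne$. A ring $R$ is strongly NUS-nil clean if every non-invertible element of $R$ is strongly square-nil clean. An element $c\in R$ is strongly clean if there is an idempotent $f=f^2\in R$ with $fc=cf$ such that $c-f$ is invertible in $R$; a ring is strongly clean if every one of its elements is strongly clean. *)

(* Defs.v *)
From HB Require Import structures.
From mathcomp Require Import all_boot all_order all_algebra.

Set Implicit Arguments.
Unset Strict Implicit.
Unset Printing Implicit Defensive.

Import GRing.Theory.
Local Open Scope ring_scope.

(* Rings are pzRingType's: the zero ring is allowed, and invertibility is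
   two-sided and not assumed to be decidable (as it would be in a
   unitRingType). *)

Section Elements.

Variable R : pzRingType.
Implicit Types a c e x : R.

Definition invertible x : Prop := exists y : R, x * y = 1 /\ y * x = 1.

Definition nilpotent_elt x : Prop := exists k : nat, x ^+ k = 0.

Definition idempotent_elt e : Prop := e ^+ 2 = e.

Definition square_idempotent e : Prop := e ^+ 2 = e ^+ 4.

Definition strongly_square_nil_clean_elt a : Prop :=
  exists e n : R,
    [/\ a = e + n, square_idempotent e, nilpotent_elt n & GRing.comm e n].

Definition strongly_clean_elt c : Prop :=
  exists f : R, [/\ idempotent_elt f, GRing.comm f c & invertible (c - f)].

End Elements.

Definition strongly_NUS_nil_clean (R : pzRingType) : Prop :=
  forall a : R, ~ invertible a -> strongly_square_nil_clean_elt a.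

Definition strongly_clean (R : pzRingType) : Prop :=
  forall c : R, strongly_clean_elt c.

(* Main.v *)
Require Import Defs.
From HB Require Import structures.
From mathcomp Require Import all_boot all_order all_algebra.
From Stdlib Require Import Classical.

(** An invertible [c] is strongly clean with [f = 0], so only a decomposition
    [c = e + n] with [e ^+ 2 = e ^+ 4], [n] nilpotent and [e n = n e] has to be
    treated. Then [g = e ^+ 2] is idempotent and commutes with [e] and [n], and
    [f = 1 - g] is the wanted idempotent: the commutative subring generated by
    [e] splits along [g] and [1 - g]. On the summand of [g], [e] squares to the identity, so [e - f] is
    the unit [e]; on the summand of [1 - g], [e] squares to zero, so
    [e - f = e - 1] is a unit as well. Hence [e - f] is invertible
    ([invertible_sub_compl]), and adding the commuting nilpotent [n] keeps it so
    ([invertible_add_nilpotent]), that is, [c - f] is invertible. *)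

Set Implicit Arguments.
Unset Strict Implicit.
Unset Printing Implicit Defensive.

Import GRing.Theory.
Local Open Scope ring_scope.

Section Invertible.

Variable R : pzRingType.
Implicit Types e m n u v x : R.

(** The inverse is the geometric series in [m], cut off where its powers
    vanish. *)
Lemma invertible_one_sub_nilpotent m : nilpotent_elt m -> invertible (1 - m).
Proof.
case=> k mk0; pose S := \sum_(i < k) m ^+ i.
have mS : (1 - m) * S = 1.
  by rewrite -opprB mulNr -subrX1 mk0 sub0r opprK.
have commS : GRing.comm (1 - m) S.
  apply: commr_sum => i _; apply: commrX.
  by apply/commr_sym/commrB; [exact: commr1 | exact: commr_refl].
by exists S; split; last rewrite -commS.
Qed.

Lemma invertibleM u v : invertible u -> invertible v -> invertible (u * v).
Proof.
move=> [u' [uu' u'u]] [v' [vv' v'v]]; exists (v' * u'); split.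
  by rewrite -mulrA (mulrA v) vv' mul1r.
by rewrite -mulrA (mulrA u') u'u mul1r.
Qed.

(** If [v] is the inverse of [u], then [v] also commutes with [n], so that
    [v * n] is nilpotent and [u + n = u (1 + v n)]. *)
Lemma invertible_add_nilpotent u n :
  invertible u -> nilpotent_elt n -> GRing.comm u n -> invertible (u + n).
Proof.
move=> u_inv [k nk0] un; have [v [uv vu]] := u_inv.
have vn : GRing.comm v n.
  by rewrite /GRing.comm -[in RHS](mul1r n) -vu -(mulrA v u n) un -!mulrA uv mulr1.
have -> : u + n = u * (1 - - (v * n)).
  by rewrite opprK mulrDr mulr1 mulrA uv mul1r.
apply: invertibleM => //; apply: invertible_one_sub_nilpotent.
by exists k; rewrite exprNn exprMn_comm // nk0 !mulr0.
Qed.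

Lemma square_idempotentP e : square_idempotent e -> idempotent_elt (e ^+ 2).
Proof. by rewrite /idempotent_elt -exprM => ->. Qed.

Lemma idempotent_compl e : idempotent_elt e -> idempotent_elt (1 - e).
Proof.
rewrite /idempotent_elt !expr2 => ee.
by rewrite mulrBl mul1r mulrBr mulr1 ee subrr subr0.
Qed.

(** With [g = e ^+ 2] and [h = 1 - g], the inverse of [e - h] is glued from the
    inverse [e] of [e] where [g] is the identity, and the inverse [- (1 + e)]
    of [e - 1] where [h] is the identity. *)
Lemma invertible_sub_compl e :
  square_idempotent e -> invertible (e - (1 - e ^+ 2)).
Proof.
move=> /square_idempotentP gg; have hh := idempotent_compl gg.
set g := e ^+ 2 in gg hh *; set h := 1 - g in hh *.
have eg : GRing.comm e g by apply: commrX.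
have eh : GRing.comm e h by apply: commrB => //; apply: commr1.
have hg : h * g = 0 by rewrite mulrBl mul1r -expr2 gg subrr.
pose v := e * g - h * (1 + e).
have uv : (e - h) * v = 1.
  have on_g : (e - h) * (e * g) = g.
    rewrite mulrBl mulrA -expr2 -/g -expr2 gg eg mulrA hg mul0r.
    by rewrite subr0.
  have on_h : (e - h) * (h * (1 + e)) = - h.
    have factored : (e - 1) * (1 + e) = - h.
      by rewrite [1 + e]addrC -subr_sqr_1 -/g opprB.
    have -> : (e - h) * (h * (1 + e)) = h * ((e - 1) * (1 + e)).
      by rewrite !mulrA mulrBl -expr2 hh eh mulrBr mulr1.
    by rewrite factored mulrN -expr2 hh.
  by rewrite mulrBr on_g on_h opprK addrC subrK.
have vcomm x : GRing.comm x e -> GRing.comm x h -> GRing.comm x v.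
  move=> xe xh; apply: commrB; apply: commrM => //; first exact: commrX.
  by apply: commrD => //; apply: commr1.
have ev : GRing.comm e v by apply: vcomm.
have hv : GRing.comm h v by apply: vcomm => //; apply: commr_sym.
have vu : v * (e - h) = 1 by rewrite mulrBr -ev -hv -mulrBl.
by exists v.
Qed.

Lemma strongly_clean_of_square_nil_clean x :
  strongly_square_nil_clean_elt x -> strongly_clean_elt x.
Proof.
move=> [e [n [-> se nn en]]]; exists (1 - e ^+ 2).
have fcomm y : GRing.comm y e -> GRing.comm y (1 - e ^+ 2).
  by move=> ye; apply: commrB; [exact: commr1 | exact: commrX].
have fe := commr_sym (fcomm e (commr_refl e)).
have fn := commr_sym (fcomm n (commr_sym en)).
split; first exact/idempotent_compl/square_idempotentP.
  exact: commrD.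
rewrite addrAC; apply: invertible_add_nilpotent => //.
  exact: invertible_sub_compl.
by apply/commr_sym/commrB; apply: commr_sym.
Qed.

Lemma strongly_clean_of_invertible x : invertible x -> strongly_clean_elt x.
Proof.
move=> x_inv; exists 0; split; last by rewrite subr0.
  by rewrite /idempotent_elt expr2 mulr0.
exact/commr_sym/commr0.
Qed.

End Invertible.

Theorem corollary2p3 (R : pzRingType) (hR : strongly_NUS_nil_clean R) :
  strongly_clean R.
Proof.
move=> c; case: (classic (invertible c)) => [c_inv | c_ninv].
  exact: strongly_clean_of_invertible.
exact/strongly_clean_of_square_nil_clean/hR.
Qed.
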